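(* Let $(x_n)_{n\in\mathbb{N}}$ be an arbitrary sequence in $[0,1)$, let $N \in \mathbb{N}$, and denote by $(x_n^* )_{n=1}^N$ the first $N$ elements of $(x_n)_{n\in\mathbb{N}}$ ordered by size, $x_1^* \le x_2^* \le \cdots \le x_N^*$. Assume that the gap lengths of $(x_n^* )_{n=1}^N$ are $L_1 < L_2 < \cdots < L_K$ and that the largest gap length satisfies $L_K = \frac{R+2}{N}$ for some $R > -1$. Let $N_1, N_2, \ldots, N_K$ denote the corresponding multiplicities of the occurring gap lengths. Let $\varepsilon$ be a real number. If for all $j = 1,\ldots,N$ we have $$x_j^* = x_1^* + \sum_{k=1}^K n_k(j) L_k$$ with $n_k(j) \in \left[ \tfrac{N_k}{N} j - \varepsilon,\ \tfrac{N_k}{N} j + \varepsilon \right]$ for $k=1,\ldots,K$, then $$D_N^*(x_1,\ldots,x_N) \le \frac{R+3}{N} + \varepsilon \sum_{k=1}^K L_k.$$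
   Context: Gap lengths are the distances between adjacent points on the circle $\mathbb{R}/\mathbb{Z}$ of length $1$, i.e. the numbers $x_{j+1}^*-x_j^*$ for $1\le j\le N-1$ together with $1 - x_N^* + x_1^*$; $L_1<\cdots<L_K$ are the distinct values occurring and $N_k$ is the number of gaps of length $L_k$, so that $\sum_{k=1}^K N_k L_k = 1$. The star-discrepancy is $$D_N^*(x_1,\ldots,x_N) := \sup_{[0,b)\subset[0,1)} \left| \tfrac1N \#\{1\le i\le N : x_i\in[0,b)\} - b\right|.$$ *)

(* Defs.v *)
From HB Require Import structures.
From mathcomp Require Import all_boot all_order all_algebra.
From mathcomp Require Import all_classical all_reals.

Set Implicit Arguments.
Unset Strict Implicit.
Unset Printing Implicit Defensive.

Import Order.TTheory GRing.Theory Num.Theory.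

Local Open Scope classical_set_scope.
Local Open Scope ring_scope.

(* Sequences are indexed from 1, so x 0 plays no role. *)
Definition first_terms (F : realType) (x : nat -> F) (N : nat) : seq F :=
  [seq x n | n <- iota 1 N].

(* order_stat x N j is x_j^* for 1 <= j <= N. *)
Definition order_stat (F : realType) (x : nat -> F) (N j : nat) : F :=
  nth 0 (sort <=%R (first_terms x N)) j.-1.

(* With multiplicity: for 0 < N this list has exactly N entries, the last one
   being the gap across 0 on the circle R/Z.  Entries are 0 at repeated points. *)
Definition gaps (F : realType) (x : nat -> F) (N : nat) : seq F :=
  rcons [seq order_stat x N j.+1 - order_stat x N j | j <- iota 1 N.-1]
        (1 - order_stat x N N + order_stat x N 1).

(* The half-open boxes [0, b) contained in [0, 1) are those with 0 <= b <= 1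
   (b = 0 gives the empty box and contributes only the value 0). *)
Definition star_discrepancy (F : realType) (s : seq F) : F :=
  sup [set `| (count (mem `[0, b[) s)%:R / (size s)%:R - b | | b in `[0, 1]].

(* Main.v *)
Require Import Defs.
From HB Require Import structures.
From mathcomp Require Import all_boot all_order all_algebra.
From mathcomp Require Import all_classical all_reals.
From mathcomp Require Import zify ring lra.

Set Implicit Arguments.
Unset Strict Implicit.
Unset Printing Implicit Defensive.

Import Order.TTheory GRing.Theory Num.Theory.

Local Open Scope ring_scope.

(** Since the gaps sum to 1, i.e. [\sum_k mult k * L_k = 1], multiplying the
    bounds on [n k j] by [L_k >= 0] and summing over [k] turns the hypothesis
    into a statement about the points alone: every [x_j^*] is within
    [d = eps * \sum_k L_k] of [x_1^* + j / N] ([gap_combination_near]).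

    Points that follow an arithmetic progression this closely have small
    discrepancy ([star_discrepancy_near]).  If [m] of them lie in the box below [b], then
    [x_m^* < b <= x_{m+1}^*], and so
    [x_1^* + m/N - d < b <= x_1^* + (m+1)/N + d].  The left half gives
    [m/N - b <= d] because [x_1^* >= 0]; the right half gives
    [b - m/N <= x_1^* + 1/N + d].  The offset [x_1^*] is at most the gap
    across 0, hence at most [L_K = (R+2)/N], and the bound [(R+3)/N + d]
    follows. *)

Section OrderStatistics.
Variables (F : realType) (x : nat -> F) (N : nat).
Hypothesis x01 : forall n : nat, (0 < n)%N -> 0 <= x n < 1.

Lemma size_first_terms : size (first_terms x N) = N.
Proof. by rewrite size_map size_iota. Qed.

Lemma first_terms01 y : y \in first_terms x N -> 0 <= y < 1.
Proof. by case/mapP=> n; rewrite mem_iota => /andP[n1 _] ->; exact: x01. Qed.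

Lemma order_stat01 j : (1 <= j <= N)%N -> 0 <= order_stat x N j < 1.
Proof.
move=> jN; apply: first_terms01; rewrite -(mem_sort <=%R) mem_nth//.
by rewrite size_sort size_first_terms; lia.
Qed.

Lemma order_stat_le i j : (1 <= i)%N -> (i <= j <= N)%N ->
  order_stat x N i <= order_stat x N j.
Proof.
move=> i1 ij; rewrite /order_stat.
apply: (le_sorted_leq_nth 0 (sort_le_sorted _));
  by rewrite ?inE ?size_sort ?size_first_terms; lia.
Qed.

(** All points are nonnegative, so the box may be replaced by the ray below
    [b]; this is what relates the count to the sorted list. *)
Lemma count_box b :
  count (mem `[0, b[) (first_terms x N)
  = count (< b) (sort <=%R (first_terms x N)).
Proof.
rewrite count_sort; apply: eq_in_count => y /first_terms01/andP[y0 _].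
by rewrite /= in_itv /= y0.
Qed.

Lemma order_stat_lt_box b (m := count (mem `[0, b[) (first_terms x N)) :
  (0 < m)%N -> order_stat x N m < b.
Proof.
move=> m0; apply: nth_count_lt; first exact: sort_le_sorted.
by rewrite -count_box -/m prednK.
Qed.

Lemma order_stat_ge_box b (m := count (mem `[0, b[) (first_terms x N)) :
  (m < N)%N -> b <= order_stat x N m.+1.
Proof.
move=> mN; apply: nth_count_ge; first exact: sort_le_sorted.
by rewrite -count_box -/m leqnn size_sort size_first_terms.
Qed.

(** The interior gaps telescope, and the gap across 0 completes the circle. *)
Lemma sum_gaps : (0 < N)%N -> \sum_(g <- gaps x N) g = 1.
Proof.
move=> N0; rewrite big_rcons big_map /=.
have -> : iota 1 N.-1 = index_iota 1 N by rewrite /index_iota subn1.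
by rewrite telescope_sumr//; lra.
Qed.

Lemma gaps_ge0 g : (0 < N)%N -> g \in gaps x N -> 0 <= g.
Proof.
move=> N0; rewrite mem_rcons inE => /predU1P[->|/mapP[j]].
  have /andP[x1 _] : 0 <= order_stat x N 1 < 1 by apply: order_stat01; lia.
  have /andP[_ xN] : 0 <= order_stat x N N < 1 by apply: order_stat01; lia.
  by lra.
by rewrite mem_iota => jN ->; rewrite subr_ge0 order_stat_le//; lia.
Qed.

Lemma order_stat1_le_gap :
  (0 < N)%N -> exists2 g, g \in gaps x N & order_stat x N 1 <= g.
Proof.
move=> N0; exists (1 - order_stat x N N + order_stat x N 1).
  by rewrite mem_rcons mem_head.
have /andP[_ xN] : 0 <= order_stat x N N < 1 by apply: order_stat01; lia.
by lra.
Qed.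

(** With [m] points in the box, its end [b] is trapped between the [m]-th and
    the next point, where the hypothesis applies; if there is no [m]-th
    (resp. no next) point, then [m / N = 0 <= b] (resp. [b <= 1 = m / N]). *)
Lemma star_discrepancy_near (c d : F) :
    (0 < N)%N -> order_stat x N 1 <= c ->
    (forall j, (1 <= j <= N)%N ->
       `|order_stat x N j - (order_stat x N 1 + j%:R / N%:R)| <= d) ->
  star_discrepancy (first_terms x N) <= c + N%:R^-1 + d.
Proof.
move=> N0 x1c near.
have /andP[x1 _] : 0 <= order_stat x N 1 < 1 by apply: order_stat01; lia.
have d0 : 0 <= d by apply: le_trans (near 1%N _); [exact: normr_ge0 | lia].
have Ngt0 : 0 < N%:R :> F by rewrite ltr0n.
have Ninv0 : 0 < N%:R^-1 :> F by rewrite invr_gt0.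
apply: ge_sup; first by exists `|(count (mem `[0, (0 : F)[) (first_terms x N))%:R
  / (size (first_terms x N))%:R - 0|, 0 => //=; rewrite in_itv /= lexx ler01.
move=> _ /= [b + <-]; rewrite in_itv /= => /andP[b0 b1].
rewrite size_first_terms.
set m := count _ _.
have mN : (m <= N)%N by rewrite -[leqRHS]size_first_terms count_size.
rewrite ler_norml; apply/andP; split.
- case: (ltnP m N) => [ltmN|leNm]; last first.
    have -> : m = N by lia.
    by rewrite divff ?gt_eqF//; lra.
  have bm := order_stat_ge_box ltmN; rewrite -/m in bm.
  have := near m.+1 ltmN; rewrite ler_norml => /andP[_].
  by rewrite -natr1 mulrDl mul1r; lra.
- have [->|m0] := posnP m; first by rewrite mul0r; lra.
  have bm := order_stat_lt_box m0; rewrite -/m in bm.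
  have := near m; rewrite m0 mN => /(_ isT); rewrite ler_norml => /andP[+ _].
  by lra.
Qed.

End OrderStatistics.

Lemma sum_count_mul (F : realType) (s t : seq F) :
    uniq t -> {subset s <= t} ->
  \sum_(y <- t) (count_mem y s)%:R * y = \sum_(y <- s) y.
Proof.
move=> ut; elim: s => [|z s IHs] st.
  by rewrite big_nil big1// => y _; rewrite mul0r.
rewrite big_cons -IHs => [|y ys]; last by rewrite st// inE ys orbT.
rewrite [in RHS](_ : z = \sum_(y <- t) (z == y)%:R * y).
  by rewrite -big_split /=; apply: eq_bigr => y _; rewrite natrD mulrDl.
rewrite (bigD1_seq z) ?st ?mem_head//= eqxx mul1r big1 ?addr0// => y.
by rewrite eq_sym => /negPf ->; rewrite mul0r.
Qed.

Lemma sorted_le_last (F : realType) (s : seq F) y :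
  sorted <%R s -> y \in s -> y <= last 0 s.
Proof.
rewrite lt_sorted_uniq_le => /andP[_ ss] ys.
have s0 : (0 < size s)%N by case: s ys {ss}.
rewrite -(nth_index 0 ys) -nth_last.
apply: (le_sorted_leq_nth 0 ss); rewrite ?inE ?index_mem// ?prednK//.
by rewrite -ltnS prednK// index_mem.
Qed.

(** The main term is [j / N] because the mean frequencies [mult k / N],
    weighted by the gap lengths, add up to [1 / N]. *)
Lemma gap_combination_near (F : realType) (K N : nat) (L a : 'I_K -> F)
    (mult : 'I_K -> nat) (eps : F) (j : nat) :
    (forall k, 0 <= L k) -> \sum_(k < K) (mult k)%:R * L k = 1 ->
    (forall k, (mult k)%:R / N%:R * j%:R - eps <= a k
         <= (mult k)%:R / N%:R * j%:R + eps) ->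
  `|\sum_(k < K) a k * L k - j%:R / N%:R| <= eps * \sum_(k < K) L k.
Proof.
move=> L0 sumL near.
have -> : j%:R / N%:R
    = \sum_(k < K) (mult k)%:R / N%:R * j%:R * L k :> F.
  rewrite -[LHS]mulr1 -[X in _ * X]sumL mulr_sumr; apply: eq_bigr => k _.
  by ring.
rewrite -sumrB mulr_sumr; apply: le_trans (ler_norm_sum _ _ _) _.
apply: ler_sum => k _; rewrite -mulrBl normrM (ger0_norm (L0 k)).
by apply: ler_wpM2r => //; have := near k; rewrite ler_norml; lra.
Qed.

Theorem theorem1p9 (F : realType) (x : nat -> F)
    (x01 : forall n : nat, (0 < n)%N -> 0 <= x n < 1)
    (N : nat) (N_gt0 : (0 < N)%N)
    (K : nat) (L : K.-tuple F)
    (L_incr : sorted <%R L) (L_gaps : L =i gaps x N)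
    (R : F) (R_gt : -1 < R) (L_max : last 0 L = (R + 2) / N%:R)
    (mult : 'I_K -> nat)
    (multE : forall k : 'I_K, mult k = count_mem (tnth L k) (gaps x N))
    (eps : F) (n : 'I_K -> nat -> F)
    (x_sum : forall j : nat, (1 <= j <= N)%N ->
       order_stat x N j = order_stat x N 1 + \sum_(k < K) n k j * tnth L k)
    (n_near : forall (j : nat) (k : 'I_K), (1 <= j <= N)%N ->
       (mult k)%:R / N%:R * j%:R - eps <= n k j
         <= (mult k)%:R / N%:R * j%:R + eps) :
  star_discrepancy (first_terms x N)
    <= (R + 3) / N%:R + eps * \sum_(k < K) tnth L k.
Proof.
have sumL : \sum_(k < K) (mult k)%:R * tnth L k = 1.
  have subL : {subset gaps x N <= L} by move=> y; rewrite L_gaps.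
  rewrite -[RHS](sum_gaps x N_gt0) -(sum_count_mul (lt_sorted_uniq L_incr) subL).
  by rewrite big_tuple; apply: eq_bigr => k _; rewrite multE.
have L0 k : 0 <= tnth L k.
  by apply: (gaps_ge0 x01 N_gt0); rewrite -L_gaps mem_tnth.
have x1 : order_stat x N 1 <= (R + 2) / N%:R.
  have [g gL x1g] := order_stat1_le_gap x01 N_gt0.
  by rewrite -L_max (le_trans x1g)// sorted_le_last// L_gaps.
have -> : (R + 3) / N%:R = (R + 2) / N%:R + N%:R^-1 by lra.
apply: star_discrepancy_near => // j jN.
rewrite x_sum// opprD addrACA subrr add0r.
exact: gap_combination_near L0 sumL (fun k => n_near j k jN).
Qed.
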